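(* Let $\mu_n$ and $\sigma_n^2$ (with $\sigma_n\ge0$) be the expected value and the variance of the random variable $X_n$, and let $A_{n,k}^*:=A_{n,k}/Q_n(1)$. Then $$\lim_{n\to\infty}\ \sup_{x\in\mathbb{R}}\left|\sigma_n\,A^*_{n,\lfloor\mu_n+x\sigma_n\rfloor}-\phi(x)\right|=0 .$$
   Context: The polynomials $Q_n(x)$ are defined by $Q_0(x)=1$ and $Q_n(x)=x\sum_{k=1}^n k\,Q_{n-k}(x)$ for $n\ge 1$. The numbers $A_{n,k}$ are their coefficients: $Q_n(x)=\sum_{k=0}^n A_{n,k}x^k$. For $n\ge1$ and $0\le k\le n$ one has $A_{n,k}=\binom{n+k-1}{2k-1}$, with $A_{n,0}=0$; for integers $k<0$ or $k>n$ set $A_{n,k}=0$. For $n\ge1$, $X_n$ is a random variable with values in $\{0,1,\dots,n\}$ and $P(X_n=k)=A_{n,k}/\sum_{m=0}^n A_{n,m}=A_{n,k}/Q_n(1)$. The function $\phi(x)=\frac{1}{\sqrt{2\pi}}e^{-x^2/2}$ is the standard normal density. *)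

(* Defs.v *)
From HB Require Import structures.
From mathcomp Require Import all_boot all_order all_algebra.
From mathcomp Require Import all_classical all_reals all_analysis.

Set Implicit Arguments.
Unset Strict Implicit.
Unset Printing Implicit Defensive.

Import Order.TTheory GRing.Theory Num.Theory.
Import numFieldNormedType.Exports.

Local Open Scope ring_scope.

Section Polynomials.
Variable R : comNzRingType.

(* The list [:: Q_0; ...; Q_n], built by course-of-values recursion. *)
Fixpoint Qseq (n : nat) : seq {poly R} :=
  match n with
  | 0%N => [:: 1]
  | m.+1 => rcons (Qseq m)
      ('X * \sum_(1 <= k < m.+2) (Qseq m)`_(m.+1 - k) *+ k)
  end.

Definition Q (n : nat) : {poly R} := (Qseq n)`_n.

Lemma size_Qseq n : size (Qseq n) = n.+1.
Proof. by elim: n => //= n IHn; rewrite size_rcons IHn. Qed.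

Lemma nth_Qseq n i : (i <= n)%N -> (Qseq n)`_i = Q i.
Proof.
elim: n => [|n IHn]; first by rewrite leqn0 => /eqP ->.
rewrite leq_eqVlt => /orP[/eqP -> //|ltin].
by rewrite /= nth_rcons size_Qseq ltin IHn.
Qed.

Lemma Q0 : Q 0 = 1.
Proof. by []. Qed.

Lemma QE n : (0 < n)%N -> Q n = 'X * \sum_(1 <= k < n.+1) Q (n - k) *+ k.
Proof.
case: n => // n _; rewrite {1}/Q /= nth_rcons size_Qseq ltnn eqxx.
congr (_ * _); apply: eq_big_nat => k /andP[k_gt0 _].
by rewrite nth_Qseq// leq_subLR -add1n leq_add2r.
Qed.

Definition A (n : nat) (k : int) : R :=
  if (0 <= k <= n%:Z) then (Q n)`_`|k|%N else 0.

End Polynomials.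

Arguments Q {R} n.
Arguments A {R} n k.

Definition Astar {R : fieldType} (n : nat) (k : int) : R := A n k / (Q n).[1].

Definition phi {R : realType} (x : R) : R :=
  (Num.sqrt (2 * pi))^-1 * expR (- (x ^+ 2) / 2).

(* Main.v *)
Require Import Defs.
From HB Require Import structures.
From mathcomp Require Import all_boot all_order all_algebra.
From mathcomp Require Import all_classical all_reals all_analysis.
From mathcomp Require Import measurable_realfun.
From mathcomp Require Import ring lra zify.

(** The proof never looks at factorials: it uses only the ratio of consecutive
coefficients and the exact first two moments.

The generating recurrence [Q_rec] gives [A n k = 'C(n + k - 1, 2 k - 1)], hence
[2 k (2 k + 1) A n (k + 1) = (n^2 - k^2) A n k] ([coefQ_ratio]).  Summing this
relation over [k] yields one equation between the mean [mu] and the variance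
[s^2], namely [5 s^2 + 5 mu^2 - 6 mu + 2 = n^2].  The mean itself is
[Q_n'(1) / Q_n(1)], a quotient of Fibonacci and Lucas numbers, and a
Cassini identity turns it into [(5 mu - 2)^2 = n^2 (5 + 4 / Q_n(1)^2)].  With
[a = n / sqrt 5] the two facts give [|mu - a| <= 1] and
[|s^2 - 2 a / 5| <= 1] ([mean_close], [var_close]).

Write [p k] for the law, [x k = (k - mu) / s] and [q k = s p k / phi (x k)]; the
claim is that [q] is close to 1 where [phi] is not negligible.  On the window
[|k - mu| <= M s] the ratio of consecutive coefficients is
[1 - (k - mu) / s^2 + O(1 / n)], exactly as for the Gaussian density, so
[q (k + 1) / q k = exp (O(1 / n))]; as the window has only [O(sqrt n)] points, [q]
is nearly constant there ([log_ratio_bounds], [ratio_telescope]).  The constant is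
found by summing over the window: by Chebyshev's inequality the [p k] sum to at
least [1 - 1 / M^2], while the [phi (x k) / s] form a Riemann sum of the normal
density, whose total mass is 1.  Hence [q] is close to 1 ([window_close]).  Outside
the window [p] is monotone on each side, so [s p k] stays below its value at the
edge, which is about [phi M], and [phi] itself is below [phi M]
([local_bound]). *)

Set Implicit Arguments.
Unset Strict Implicit.
Unset Printing Implicit Defensive.

Import Order.TTheory GRing.Theory Num.Theory.
Import numFieldNormedType.Exports.

Local Open Scope classical_set_scope.
Local Open Scope ring_scope.

(** * Coefficients of Q and their values at 1 *)

Section Combinatorics.
Variable R : comNzRingType.
Implicit Types n k : nat.

Lemma Q1 : Q 1 = 'X :> {poly R}.
Proof. by rewrite QE// big_nat1 subnn Q0 mulr1n mulr1. Qed.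

Lemma Q2 : Q 2 = (2 + 'X) * 'X :> {poly R}.
Proof.
rewrite QE// big_nat_recl// big_nat1 /= subSS subn0 subnn Q0 Q1.
by rewrite mulr1n mulrC addrC.
Qed.

(** The defining sum is a convolution of [Q] with the sequence of integers, whose
second difference is a unit mass; so the second difference of [Q] is local. *)
Lemma Q_rec n : Q n.+3 = (2 + 'X) * Q n.+2 - Q n.+1 :> {poly R}.
Proof.
pose S m : {poly R} := \sum_(1 <= k < m.+1) Q (m - k) *+ k.
pose U m : {poly R} := \sum_(0 <= k < m.+1) Q (m - k).
have S_rec m : S m.+1 = S m + U m.
  rewrite /S /U big_add1 /= [X in _ = X + _](_ : _ = \sum_(0 <= k < m.+1) Q (m - k) *+ k).
    by rewrite -big_split /=; apply: eq_bigr => k _; rewrite subSS mulrSr.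
  by rewrite [RHS]big_nat_recl// mulr0n add0r big_add1.
have U_rec m : U m.+1 = Q m.+1 + U m.
  by rewrite /U big_nat_recl// subn0; congr (_ + _); apply: eq_bigr.
rewrite !QE// -!/(S _) !S_rec !U_rec (QE _ (ltn0Sn n.+1)) -!/(S _) !S_rec !U_rec.
by rewrite (QE _ (ltn0Sn n)) -!/(S _) !S_rec; ring.
Qed.

Lemma coefQ0 n : (Q n.+1)`_0 = 0 :> R.
Proof. by rewrite QE// coefXM. Qed.

(** The binomial closed form satisfies the recurrence [Q_rec], read on
coefficients. *)
Lemma bin_second_difference n k :
  ('C(n + k.+1, k.+1.*2.+1) + 'C(n.+2 + k.+1, k.+1.*2.+1) =
   2 * 'C(n.+1 + k.+1, k.+1.*2.+1) + 'C(n.+1 + k, k.*2.+1))%N.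
Proof.
rewrite doubleS !addSn !addnS !binS; lia.
Qed.

Lemma coefQ n k : (Q n.+1)`_k.+1 = 'C(n.+1 + k, k.*2.+1)%:R :> R.
Proof.
suff H m : (forall k, (Q m.+1)`_k.+1 = 'C(m.+1 + k, k.*2.+1)%:R :> R)
    /\ (forall k, (Q m.+2)`_k.+1 = 'C(m.+2 + k, k.*2.+1)%:R :> R) by case: (H n).
elim: m => [|m [IH1 IH2]].
  split=> -[|j]; rewrite ?Q1 ?Q2 ?mulrDl ?mul1r ?coefD.
  - by rewrite coefX bin1.
  - by rewrite coefX bin_small// ; lia.
  - by rewrite !coefX coefXM coefX addr0 bin1.
  - rewrite !coefX coefXM coefX /= !add0r; case: j => [|j] //=.
    by rewrite bin_small//; lia.
split=> // -[|j].
  rewrite Q_rec mulrDl [2 * _]mulr_natl coefB coefD coefMn coefXM coefQ0 IH1 IH2.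
  rewrite !bin1 addr0 -mulrnA -natrB; last by lia.
  by congr _%:R; lia.
rewrite Q_rec mulrDl [2 * _]mulr_natl coefB coefD coefMn coefXM /= IH1 !IH2.
apply/eqP; rewrite subr_eq -mulrnA -!natrD; apply/eqP; congr _%:R.
have := bin_second_difference m.+1 j; lia.
Qed.

Lemma coefQ_gt n k : (n.+1 < k)%N -> (Q n.+1)`_k = 0 :> R.
Proof. by case: k => // k nk; rewrite coefQ bin_small//; lia. Qed.

Lemma size_Q n : (size (Q n.+1 : {poly R}) <= n.+2)%N.
Proof. by apply/leq_sizeP => k nk; apply: coefQ_gt. Qed.

(** Multiplying out the denominator of the ratio of two consecutive coefficients
keeps the identity true for all [k], including [k = 0] and [k > n]. *)
Lemma coefQ_ratio n k :
  ((2 * k * (2 * k + 1))%:R * (Q n.+1)`_k.+1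
   = (n.+1%:R ^+ 2 - k%:R ^+ 2) * (Q n.+1)`_k :> R).
Proof.
case: k => [|k]; first by rewrite coefQ0 mulr0 !mul0r.
rewrite !coefQ.
have [kn|nk] := leqP k n; last first.
  by rewrite !bin_small ?mulr0//; lia.
have -> : n.+1%:R ^+ 2 - k.+1%:R ^+ 2 = ((n.+1 ^ 2 - k.+1 ^ 2)%N)%:R :> R.
  by rewrite natrB ?leq_exp2r// !natrX.
rewrite -!natrM; congr _%:R.
have -> : (2 * k.+1 * (2 * k.+1 + 1) = k.*2.+2 * k.*2.+3)%N by lia.
have := mul_bin_diag (n.+1 + k).+1 k.+1.*2; have := mul_bin_left (n.+1 + k) k.*2.+1.
have -> : (n.+1 + k - k.*2.+1 = n - k)%N by lia.
rewrite addnS /= doubleS => e1 e2.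
rewrite -mulnA -e2 mulnCA e1 mulnA; congr (_ * _)%N; nia.
Qed.

Lemma hornerQ_rec n : (Q n.+3).[1] = 3 * (Q n.+2).[1] - (Q n.+1).[1] :> R.
Proof. by rewrite Q_rec !hornerE; ring. Qed.

Lemma derivQ_rec n : (Q n.+3)^`().[1]
  = 3 * (Q n.+2)^`().[1] - (Q n.+1)^`().[1] + (Q n.+2).[1] :> R.
Proof. by rewrite Q_rec !poly.derivE !hornerE; ring. Qed.

(** The values at 1 are the Fibonacci numbers of even index, and this is a form of
Cassini's identity: the left-hand side is an invariant of the recurrence. *)
Lemma hornerQ_cassini n :
  (Q n.+2).[1] ^+ 2 - 3 * (Q n.+2).[1] * (Q n.+1).[1] + (Q n.+1).[1] ^+ 2 = 1 :> R.
Proof.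
elim: n => [|n IH]; first by rewrite Q2 Q1 !hornerE; ring.
by rewrite hornerQ_rec -[RHS]IH; ring.
Qed.

(** The factor [2 * (Q n.+2).[1] - 3 * (Q n.+1).[1]] is the Lucas number that goes
with the Fibonacci number [(Q n.+1).[1]]; the derivative, a self-convolution of
Fibonacci numbers, is a combination of the two. *)
Lemma derivQ_closed n : 5 * (Q n.+1)^`().[1]
  = n.+1%:R * (2 * (Q n.+2).[1] - 3 * (Q n.+1).[1]) + 2 * (Q n.+1).[1] :> R.
Proof.
suff H m : 5 * (Q m.+1)^`().[1]
  = m.+1%:R * (2 * (Q m.+2).[1] - 3 * (Q m.+1).[1]) + 2 * (Q m.+1).[1] :> R
  /\ 5 * (Q m.+2)^`().[1]
  = m.+2%:R * (2 * (Q m.+3).[1] - 3 * (Q m.+2).[1]) + 2 * (Q m.+2).[1] :> R.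
  by case: (H n).
elim: m => [|m [IH1 IH2]]; first by
  split; rewrite ?hornerQ_rec Q2 Q1 !poly.derivE !hornerE /=; ring.
split=> //; rewrite derivQ_rec mulrDr mulrBr mulrCA IH1 IH2 !hornerQ_rec; ring.
Qed.

End Combinatorics.

(** * Mean and variance of the coefficient law *)

Section Moments.
Variable R : rcfType.
Implicit Types n k : nat.

Definition probQ n k : R := (Q n.+1)`_k / (Q n.+1).[1].

Lemma coefQ_ge0 n k : 0 <= (Q n.+1)`_k :> R.
Proof. by case: k => [|k]; rewrite ?coefQ0// coefQ. Qed.

Lemma hornerQ_growth n :
  n.+1%:R <= (Q n.+1).[1] :> R /\ 2 * (Q n.+1).[1] <= (Q n.+2).[1] :> R.
Proof.
elim: n => [|n [IH1 IH2]]; first by rewrite Q2 Q1 !hornerE /=; split; lra.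
have : 1 <= n.+1%:R :> R by rewrite ler1n.
by rewrite hornerQ_rec -[n.+2%:R]natr1; split; lra.
Qed.

Lemma hornerQ_gt0 n : 0 < (Q n.+1).[1] :> R.
Proof. by apply: lt_le_trans (hornerQ_growth n).1; rewrite ltr0n. Qed.

Lemma sum_coefQ n : \sum_(0 <= k < n.+2) (Q n.+1)`_k = (Q n.+1).[1] :> R.
Proof.
rewrite (horner_coef_wide _ (size_Q R n)) big_mkord.
by apply: eq_bigr => k _; rewrite expr1n mulr1.
Qed.

Lemma sum_mul_coefQ n :
  \sum_(0 <= k < n.+2) k%:R * (Q n.+1)`_k = (Q n.+1)^`().[1] :> R.
Proof.
have szd : (size (Q n.+1 : {poly R})^`() <= n.+1)%N.
  by apply/leq_sizeP => k nk; rewrite coef_deriv coefQ_gt ?mul0rn.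
rewrite (horner_coef_wide _ szd) big_nat_recl// mul0r add0r big_mkord.
by apply: eq_bigr => k _; rewrite expr1n mulr1 coef_deriv mulr_natl.
Qed.

(** This is [coefQ_ratio] summed over [k]: shifting the index on its left-hand side
turns [2 k (2 k + 1)] into [2 (k - 1) (2 k - 1)]. *)
Lemma sum_sqr_coefQ n :
  \sum_(0 <= k < n.+2) (5 * k%:R ^+ 2 - 6 * k%:R + 2) * (Q n.+1)`_k
  = n.+1%:R ^+ 2 * (Q n.+1).[1] :> R.
Proof.
pose h k : R := 2 * (k%:R - 1) * (2 * k%:R - 1) * (Q n.+1)`_k.
have shift : \sum_(0 <= k < n.+2) h k = \sum_(0 <= k < n.+2) h k.+1.
  have -> : \sum_(0 <= k < n.+2) h k = \sum_(0 <= k < n.+3) h k.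
    by rewrite [RHS]big_nat_recr//= [h n.+2]/h coefQ_gt// mulr0 addr0.
  by rewrite [LHS]big_nat_recl// {1}/h coefQ0 mulr0 add0r.
rewrite -sum_coefQ mulr_sumr; apply/eqP; rewrite -subr_eq0 -sumrB.
rewrite (eq_bigr (fun k => h k - h k.+1)); first by rewrite sumrB shift subrr.
move=> k _; rewrite /h.
have -> : 2 * (k.+1%:R - 1) * (2 * k.+1%:R - 1) * (Q n.+1)`_k.+1
  = (2 * k * (2 * k + 1))%:R * (Q n.+1)`_k.+1 :> R.
  by rewrite !(natrM, natrD) -natr1; ring.
by rewrite coefQ_ratio; ring.
Qed.

Lemma sum_probQ n : \sum_(0 <= k < n.+2) probQ n k = 1.
Proof. by rewrite -mulr_suml sum_coefQ divff// gt_eqF// hornerQ_gt0. Qed.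

(** One equation between mean and variance comes for free from the ratio of
coefficients, so that only the mean needs a closed form. *)
Lemma mean_var_rel n mu v :
  \sum_(0 <= k < n.+2) k%:R * probQ n k = mu ->
  \sum_(0 <= k < n.+2) (k%:R - mu) ^+ 2 * probQ n k = v ->
  5 * v + 5 * mu ^+ 2 - 6 * mu + 2 = n.+1%:R ^+ 2.
Proof.
move=> muE vE.
have f0 : (Q n.+1).[1] != 0 :> R by rewrite gt_eqF// hornerQ_gt0.
have : \sum_(0 <= k < n.+2) (5 * k%:R ^+ 2 - 6 * k%:R + 2) * probQ n k = n.+1%:R ^+ 2.
  apply: (mulIf f0); rewrite -sum_sqr_coefQ mulr_suml; apply: eq_bigr => k _.
  by rewrite /probQ -mulrA divfK.
move=> <-; rewrite (eq_bigr (fun k : nat => 5 * ((k%:R - mu) ^+ 2 * probQ n k)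
  + (10 * mu - 6) * (k%:R * probQ n k) + (2 - 5 * mu ^+ 2) * probQ n k)); last first.
  by move=> k _; ring.
by rewrite !big_split /= -!mulr_sumr sum_probQ muE vE; ring.
Qed.

Lemma mean_sqr_bounds n a mu :
  5 * a ^+ 2 = n.+1%:R ^+ 2 ->
  \sum_(0 <= k < n.+2) k%:R * probQ n k = mu ->
  0 <= 5 * mu - 2 /\
  25 * a ^+ 2 <= (5 * mu - 2) ^+ 2 <= 25 * a ^+ 2 + 4.
Proof.
move=> aE muE.
(* [5 mu - 2] is [n L / f] with [L] the Lucas number, and [L^2 = 5 f^2 + 4]; the
   excess [4 n^2 / f^2] is at most 4 because [f >= n]. *)
have [f_ge g2f] := hornerQ_growth n; have := hornerQ_gt0 n.
have := hornerQ_cassini R n; have := derivQ_closed R n.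
rewrite -sum_mul_coefQ; move: f_ge g2f.
set f := (Q n.+1).[1]; set g := (Q n.+2).[1] => f_ge g2f D cas f0.
have -> : 5 * mu - 2 = n.+1%:R * ((2 * g - 3 * f) / f).
  apply: (mulIf (lt0r_neq0 f0)); rewrite mulrBl.
  have -> : 5 * mu * f = 5 * (mu * f) by ring.
  have -> : mu * f = \sum_(0 <= k < n.+2) k%:R * (Q n.+1)`_k.
    rewrite -muE mulr_suml; apply: eq_bigr => k _.
    by rewrite /probQ -mulrA divfK// lt0r_neq0.
  by rewrite D -mulrA divfK ?lt0r_neq0//; ring.
split; first by rewrite mulr_ge0// divr_ge0; lra.
have -> : (n.+1%:R * ((2 * g - 3 * f) / f)) ^+ 2
   = 25 * a ^+ 2 + 4 * (n.+1%:R / f) ^+ 2.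
  rewrite !exprMn.
  have -> : (2 * g - 3 * f) ^+ 2 = 4 + 5 * f ^+ 2.
    by lra.
  have -> : 25 * a ^+ 2 = 5 * n.+1%:R ^+ 2 by rewrite -aE; ring.
  by field; rewrite lt0r_neq0.
have : 0 <= (n.+1%:R / f) ^+ 2 <= 1.
  rewrite sqr_ge0 expr_le1//; first by rewrite ler_pdivrMr ?mul1r.
  by rewrite divr_ge0// ltW.
by move=> /andP[? ?]; apply/andP; split; lra.
Qed.

(** Here and below [a] stands for [n.+1 / sqrt 5], the asymptotic mean. *)
Lemma mean_close n a mu :
  0 <= a -> 5 * a ^+ 2 = n.+1%:R ^+ 2 ->
  \sum_(0 <= k < n.+2) k%:R * probQ n k = mu ->
  `|mu - a| <= 1.
Proof.
move=> a0 aE muE.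
have [v0 /andP[lo hi]] := mean_sqr_bounds aE muE.
have h1 : 5 * a <= 5 * mu - 2.
  rewrite -(@ler_pXn2r _ 2)// ?nnegrE//; last by rewrite mulr_ge0.
  by apply: le_trans lo; lra.
have h2 : 5 * mu - 2 <= 5 * a + 2.
  rewrite -(@ler_pXn2r _ 2)// ?nnegrE//; last by lra.
  by apply: (le_trans hi); nra.
by rewrite ler_norml; lra.
Qed.

Lemma var_close n a mu v :
  0 <= a -> 5 * a ^+ 2 = n.+1%:R ^+ 2 ->
  \sum_(0 <= k < n.+2) k%:R * probQ n k = mu ->
  \sum_(0 <= k < n.+2) (k%:R - mu) ^+ 2 * probQ n k = v ->
  `|v - 2 / 5 * a| <= 1.
Proof.
move=> a0 aE muE vE.
have [v0 /andP[lo hi]] := mean_sqr_bounds aE muE.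
have := mean_close a0 aE muE; have := mean_var_rel muE vE; rewrite -aE => e.
rewrite !ler_norml => /andP[? ?].
by apply/andP; split; nra.
Qed.

End Moments.

(** * Moments of a random variable with finitely many natural values *)

(** Nonnegativity of [h] spares an integrability proof; it holds for the two
functions used for the mean and for the variance. *)
Lemma integral_natvalued d (T : measurableType d) (R : realType)
    (P : probability T R) (X : {RV P >-> R}) (n : nat) (h : R -> R) :
  (forall w, exists2 k : nat, (k <= n)%N & X w = k%:R) ->
  (forall x, 0 <= h x) ->
  (\int[P]_w (h (X w))%:E = (\sum_(0 <= k < n.+1) h k%:R * pmf X k%:R)%:E)%E.
Proof.
move=> Xn h0; pose B (k : nat) := X @^-1` [set k%:R].
have mB k : measurable (B k) by rewrite -[B k]setTI; exact: measurable_funP.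
transitivity (\int[P]_w (\sum_(0 <= k < n.+1) (h k%:R * \1_(B k) w)%:E))%E.
  apply: eq_integral => w _; rewrite sumEFin; congr (_%:E).
  have [j jn Xj] := Xn w.
  rewrite (bigD1_seq j) ?mem_index_iota ?iota_uniq//= big1_seq.
    by rewrite Xj indicE mem_set//= mulr1 addr0.
  move=> k /andP[kj _]; rewrite indicE memNset ?mulr0//= /B/= Xj => /eqP.
  by rewrite eqr_nat eq_sym (negbTE kj).
rewrite ge0_integral_sum//; last 2 first.
- by move=> k; apply/measurable_EFinP; apply: measurable_funM.
- by move=> k w _; rewrite lee_fin mulr_ge0.
rewrite -sumEFin; apply: eq_bigr => k _.
under eq_integral do rewrite EFinM.
rewrite ge0_integralZl_EFin//; last first.
  exact/measurable_EFinP.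
by rewrite integral_indic// setIT EFinM /pmf fineK// fin_num_measure.
Qed.

Lemma expectation_natvalued d (T : measurableType d) (R : realType)
    (P : probability T R) (X : {RV P >-> R}) (n : nat) :
  (forall w, exists2 k : nat, (k <= n)%N & X w = k%:R) ->
  ('E_P[X] = (\sum_(0 <= k < n.+1) k%:R * pmf X k%:R)%:E)%E.
Proof.
move=> Xn; rewrite unlock.
(* The values are nonnegative, so taking [h] to be the norm loses nothing. *)
transitivity (\int[P]_w `|X w|%:E)%E.
  by apply: eq_integral => w _; have [k _ ->] := Xn w; rewrite ger0_norm.
rewrite (integral_natvalued Xn (h := fun x => `|x|))//.
by congr (_%:E); apply: eq_bigr => k _; rewrite ger0_norm.
Qed.

Lemma variance_natvalued d (T : measurableType d) (R : realType)
    (P : probability T R) (X : {RV P >-> R}) (n : nat) (mu : R) :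
  (forall w, exists2 k : nat, (k <= n)%N & X w = k%:R) ->
  ('E_P[X] = mu%:E)%E ->
  ('V_P[X] = (\sum_(0 <= k < n.+1) (k%:R - mu) ^+ 2 * pmf X k%:R)%:E)%E.
Proof.
move=> Xn Emu; rewrite /variance unlock Emu /= unlock.
rewrite -(integral_natvalued Xn (h := fun x => (x - mu) ^+ 2)) //.
by move=> x; exact: sqr_ge0.
Qed.

(** * The standard normal density and distribution function *)

Section Gauss.
Variable R : realType.
Implicit Types x y : R.

Lemma phi_normal_pdf : phi = normal_pdf 0 1 :> (R -> R).
Proof.
apply/funext => x; rewrite normal_pdfE ?oner_eq0// /normal_peak /normal_fun /phi.
by rewrite subr0 expr1n mul1r mulr_natl.
Qed.

Lemma phi_gt0 x : 0 < phi x.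
Proof. by rewrite mulr_gt0 ?expR_gt0// invr_gt0 sqrtr_gt0 mulr_gt0// pi_gt0. Qed.

Lemma phi_peak_le1 : (Num.sqrt (2 * pi))^-1 <= 1 :> R.
Proof.
have pi2 := @pi_ge2 R.
rewrite invf_le1 ?sqrtr_gt0 ?mulr_gt0 ?pi_gt0// -[leLHS]sqrtr1 ler_wsqrtr//; lra.
Qed.

Lemma phi_le1 x : phi x <= 1.
Proof.
rewrite /phi mulr_ile1 ?expR_ge0 ?invr_ge0 ?sqrtr_ge0 ?phi_peak_le1//.
by rewrite expR_le1; have := sqr_ge0 x; lra.
Qed.

Lemma phi_shift x y : phi y = phi x * expR ((x ^+ 2 - y ^+ 2) / 2).
Proof. by rewrite /phi -mulrA -expRD; congr (_ * expR _); field. Qed.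

Lemma le_phi x y : `|x| <= `|y| -> phi y <= phi x.
Proof.
move=> xy; rewrite (phi_shift x y) ler_piMr ?(ltW (phi_gt0 x))//.
rewrite expR_le1.
by move: xy; rewrite -ler_sqr ?nnegrE// !real_normK ?num_real//; lra.
Qed.

Lemma is_derive_phi x : is_derive x (1 : R) phi (- x * phi x).
Proof.
rewrite /phi; apply: is_derive_eq.
by rewrite /GRing.scale /=; move: (expR _) (_^-1) => e c; field.
Qed.

(** This bounds the derivative of [phi], and it also gives the tail estimate
[phi M <= 1 / M]. *)
Lemma abs_mul_phi_le1 x : `|x| * phi x <= 1.
Proof.
have h : `|x| * expR (- x ^+ 2 / 2) <= 1.
  have -> : - x ^+ 2 / 2 = - (x ^+ 2 / 2) by ring.
  rewrite expRN ler_pdivrMr ?expR_gt0// mul1r.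
  apply: le_trans (expR_ge1Dx _); rewrite -(real_normK (num_real x)).
  by have := sqr_ge0 (`|x| - 1); rewrite sqrrB1; lra.
by rewrite /phi mulrCA mulr_ile1 ?phi_peak_le1 ?mulr_ge0 ?expR_ge0.
Qed.

Lemma phi_lipschitz x y : `|phi x - phi y| <= `|x - y|.
Proof.
wlog xy : x y / x < y.
  move=> H; have [/H//|/H|->] := ltgtP x y; last by rewrite !subrr.
  by rewrite distrC (distrC x).
have [c _ e] := @MVT R phi (fun z => - z * phi z) x y xy
  (fun z _ => is_derive_phi z)
  (derivable_within_continuous (fun z _ => @ex_derive _ _ _ _ _ _ _ (is_derive_phi z))).
rewrite distrC e normrM normrM normrN (gtr0_norm (phi_gt0 c)) (distrC x).
by rewrite ler_piMl// abs_mul_phi_le1.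
Qed.

Local Notation P01 := (normal_prob (0 : R) 1).

(** The error of the left-endpoint rectangle rule on one interval, by the
1-Lipschitz property. *)
Lemma normal_prob_itv_bound x y : x <= y ->
  `|fine (P01 `]x, y]) - (y - x) * phi x| <= (y - x) ^+ 2.
Proof.
move=> xy; have Pfin : P01 `]x, y] \is a fin_num by exact: fin_num_measure.
have cst_int c : (\int[lebesgue_measure]_(z in `]x, y]) (cst c%:E z) = ((y - x) * c)%:E)%E.
  rewrite integral_cst//= lebesgue_measure_itv/= lte_fin.
  by case: ltgtP xy => [xy _|//|<- _]; rewrite ?subrr ?mul0r ?mule0// -EFinB -EFinM mulrC.
have phi_int : lebesgue_measure.-integrable `]x, y] (EFin \o phi).
  by rewrite phi_normal_pdf; apply: integrableS (integrable_normal_pdf 0 1).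
have cstint c : lebesgue_measure.-integrable `]x, y] (cst c%:E).
  apply/integrableP; split => //; rewrite integral_cst//= lebesgue_measure_itv/=.
  by case: ifP => // _; rewrite ?mule0// -EFinB -EFinM ltry.
have phi_near z : z \in `]x, y]%classic -> `|phi z - phi x| <= y - x.
  rewrite inE/= in_itv/= => /andP[xz zy]; apply: le_trans (phi_lipschitz _ _) _.
  by rewrite ger0_norm; lra.
have up : fine (P01 `]x, y]) <= (y - x) * (phi x + (y - x)).
  rewrite -lee_fin fineK// -cst_int /normal_prob -phi_normal_pdf.
  apply: le_integral => // z /phi_near; rewrite ler_norml lee_fin /=; lra.
have lo : (y - x) * (phi x - (y - x)) <= fine (P01 `]x, y]).
  rewrite -lee_fin fineK// -cst_int /normal_prob -phi_normal_pdf.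
  apply: le_integral => // z /phi_near; rewrite ler_norml lee_fin /=; lra.
by rewrite ler_norml; apply/andP; split; nra.
Qed.

Definition Phi x : R := fine (P01 `]-oo, x]).

Lemma Phi_ge0 x : 0 <= Phi x. Proof. exact/fine_ge0/measure_ge0. Qed.

Lemma Phi_le1 x : Phi x <= 1.
Proof.
rewrite -lee_fin fineK; first exact: probability_le1.
exact: fin_num_measure.
Qed.

Lemma Phi_increment x y : x <= y -> Phi y - Phi x = fine (P01 `]x, y]).
Proof.
move=> xy; have e : `]-oo, y]%classic = `]-oo, x]%classic `|` `]x, y]%classic :> set R.
  by rewrite -itv_bndbnd_setU ?bnd_simp.
rewrite /Phi e measureU//; last first.
  rewrite -subset0 => z []/=; rewrite !in_itv/= => zx /andP[xz _].
  by move: xz; rewrite ltNge zx.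
rewrite fineD ?fin_num_measure// addrC addKr//.
Qed.

Lemma Phi_nondecreasing x y : x <= y -> Phi x <= Phi y.
Proof. by move=> xy; rewrite -subr_ge0 Phi_increment// fine_ge0. Qed.

Lemma Phi_step x y : x <= y -> `|Phi y - Phi x - (y - x) * phi x| <= (y - x) ^+ 2.
Proof. by move=> xy; rewrite Phi_increment//; exact: normal_prob_itv_bound. Qed.

Lemma Phi_tails e : 0 < e ->
  exists M0 : R, forall M, M0 <= M -> 1 - e <= Phi M - Phi (- M).
Proof.
move=> e0; pose F n : set (measurableTypeR R) := `]- n%:R, n%:R]%classic.
have nF n : (- n%:R : R) <= n%:R by rewrite (@le_trans _ _ 0)// oppr_le0.
have FT : \bigcup_n F n = setT.
  rewrite -subTset => z _; exists (Num.truncn `|z|).+1 => //; rewrite /F /= in_itv/=.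
  have := truncnS_gt `|z|; rewrite ltr_norml => /andP[-> /ltW].
  by [].
have cvgF : (P01 \o F) n @[n --> \oo] --> P01 (\bigcup_n F n).
  apply: nondecreasing_cvg_mu; first by move=> n; exact: measurable_itv.
    by rewrite FT.
  move=> n m nm; apply/subsetPset => z; rewrite /F /= !in_itv/= => /andP[nz zn].
  have : n%:R <= m%:R :> R by rewrite ler_nat.
  by lra.
move: cvgF; rewrite FT probability_setT => /fine_cvgP[_ /cvgrPdist_le /(_ e e0)].
move=> [n _ /(_ n (leqnn n))]; rewrite /= -Phi_increment// => Hn.
exists n%:R => M nM; move: Hn; rewrite ler_norml => /andP[_].
have := Phi_nondecreasing nM.
have : Phi (- M) <= Phi (- n%:R) by apply: Phi_nondecreasing; rewrite lerN2.
by lra.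
Qed.
End Gauss.

(** * From ratios of consecutive probabilities to a local limit bound *)

Section LocalLimit.
Variable R : realType.
Implicit Types (p : nat -> R) (lo hi k n N : nat) (mu s M e eta : R).

Definition standardize mu s k : R := (k%:R - mu) / s.

Lemma standardizeS mu s k :
  standardize mu s k.+1 = standardize mu s k + s^-1.
Proof. by rewrite /standardize -natr1; ring. Qed.

Lemma riemann_phi mu s lo n : 0 < s ->
  `|\sum_(lo <= k < lo + n) phi (standardize mu s k) / s
    - (Phi (standardize mu s (lo + n)) - Phi (standardize mu s lo))|
    <= n%:R / s ^+ 2.
Proof.
move=> s0; pose x := standardize mu s; rewrite -!/(x _); elim: n => [|n IH].
  by rewrite addn0 big_geq// subrr subr0 normr0 mul0r.
rewrite addnS big_nat_recr ?leq_addr//=.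
have xle : x (lo + n)%N <= x (lo + n).+1.
  by rewrite [leRHS]standardizeS lerDl invr_ge0 ltW.
have dx : x (lo + n).+1 - x (lo + n)%N = s^-1.
  by rewrite /x standardizeS addrAC subrr add0r.
have := Phi_step xle; rewrite dx.
rewrite -[n.+1%:R]natr1 mulrDl mul1r exprVn mulrC; move: IH.
rewrite !ler_norml => /andP[? ?] /andP[? ?]; apply/andP; split; lra.
Qed.

(** Chebyshev's inequality for the finite distribution [p]. The window may be larger
than the interval of radius [M s]: only what lies outside it has to be far from
the mean. *)
Lemma chebyshev_window p N lo hi mu s M : 0 < s -> 0 < M ->
  (forall k, 0 <= p k) ->
  \sum_(0 <= k < N) p k = 1 ->
  \sum_(0 <= k < N) (k%:R - mu) ^+ 2 * p k = s ^+ 2 ->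
  (lo <= hi)%N -> (hi <= N)%N ->
  (forall k, (k < lo)%N -> k%:R <= mu - M * s) ->
  (forall k, (hi <= k)%N -> mu + M * s <= k%:R) ->
  1 - M ^- 2 <= \sum_(lo <= k < hi) p k.
Proof.
move=> s0 M0 p0 p1 pv lohi hiN klo khi.
pose w k := (k%:R - mu) ^+ 2 * p k / (M * s) ^+ 2.
have Ms0 : 0 < M * s by rewrite mulr_gt0.
have w_tail k : M * s <= `|k%:R - mu| -> p k <= w k.
  move=> h; rewrite /w ler_pdivlMr ?exprn_gt0// mulrC ler_wpM2r//.
  by rewrite -[leRHS]real_normK ?num_real// ler_sqr ?nnegrE// ltW.
have w0 k : 0 <= w k by rewrite /w divr_ge0 ?sqr_ge0// mulr_ge0 ?sqr_ge0.
have wsum : \sum_(0 <= k < N) w k = M ^- 2.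
  by rewrite -mulr_suml pv; field; rewrite !gt_eqF.
have split3 (f : nat -> R) : \sum_(0 <= k < N) f k =
    \sum_(0 <= k < lo) f k + \sum_(lo <= k < hi) f k + \sum_(hi <= k < N) f k.
  rewrite (big_cat_nat (n := hi))// ?(leq_trans lohi)//=; congr (_ + _).
  by rewrite (big_cat_nat (n := lo)).
have left : \sum_(0 <= k < lo) p k <= \sum_(0 <= k < lo) w k.
  rewrite big_nat [leRHS]big_nat; apply: ler_sum => k /andP[_ kl].
  apply: w_tail; rewrite distrC ger0_norm; have := klo _ kl; lra.
have right : \sum_(hi <= k < N) p k <= \sum_(hi <= k < N) w k.
  rewrite big_nat [leRHS]big_nat; apply: ler_sum => k /andP[kh _].
  apply: w_tail; rewrite ger0_norm; have := khi _ kh; lra.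
have mid : 0 <= \sum_(lo <= k < hi) w k by apply: sumr_ge0.
move: p1 wsum; rewrite !split3; lra.
Qed.

Lemma ratio_telescope (q : nat -> R) eta lo n :
  (forall k, (lo <= k < lo + n)%N ->
     q k.+1 <= expR eta * q k /\ q k <= expR eta * q k.+1) ->
  q (lo + n)%N <= expR (n%:R * eta) * q lo /\
  q lo <= expR (n%:R * eta) * q (lo + n)%N.
Proof.
elim: n => [|n IH] H; first by rewrite addn0 mul0r expR0 mul1r.
have [|IH1 IH2] := IH.
  by move=> k /andP[lk kn]; apply: H; rewrite lk addnS ltnW.
have [|H1 H2] := H (lo + n)%N; first by rewrite leq_addr addnS ltnSn.
rewrite addnS -[n.+1%:R]natr1 mulrDl mul1r expRD; split.
  apply: le_trans H1 _; rewrite [_ * expR eta]mulrC -mulrA.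
  by rewrite ler_wpM2l ?expR_ge0.
by apply: le_trans IH2 _; rewrite -mulrA ler_wpM2l ?expR_ge0.
Qed.

(** The constant 8 is a convenient rounding: to first order in [e] the hypotheses
confine [y] to [1 - 3 e, 1 + 3 e]. *)
Lemma normB1_le8 e (y : R) : 0 <= e -> e <= 8^-1 ->
  y * (1 - 2 * e) <= 1 + e -> 1 - e <= y * (1 + e) ^+ 2 -> `|y - 1| <= 8 * e.
Proof.
move=> e0' e8' hup hdn.
rewrite ler_norml; apply/andP; split.
  have : (1 - 8 * e) * (1 + e) ^+ 2 <= y * (1 + e) ^+ 2 by apply: le_trans hdn; nra.
  by rewrite ler_pM2r ?exprn_gt0; lra.
have : y * (1 - 2 * e) <= (1 + 8 * e) * (1 - 2 * e) by apply: (le_trans hup); nra.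
by rewrite ler_pM2r; lra.
Qed.

(** The setting of one fixed distribution [p] with mean [mu] and standard deviation
[s], observed on the indices from [lo] to [hi]. All the asymptotics is condensed in
one error [e]: the normal mass missed by the window, the Chebyshev defect
[M ^- 2], the total mesh error of the Riemann sum, and the total distortion of [q]
across the window are each at most [e]. *)
Section Window.
Variables (p : nat -> R) (N lo hi : nat) (mu s M eta e : R).
Hypotheses (s0 : 0 < s) (M0 : 0 < M) (eta0 : 0 <= eta).
Hypothesis p0 : forall k, 0 <= p k.
Hypothesis p1 : \sum_(0 <= k < N) p k = 1.
Hypothesis pv : \sum_(0 <= k < N) (k%:R - mu) ^+ 2 * p k = s ^+ 2.
Hypotheses (lohi : (lo <= hi)%N) (hiN : (hi <= N)%N).
Hypothesis klo : forall k, (k < lo)%N -> k%:R <= mu - M * s.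
Hypothesis khi : forall k, (hi <= k)%N -> mu + M * s <= k%:R.
Let x := standardize mu s.
Let q k := s * p k / phi (x k).
Hypothesis ratio : forall k, (lo <= k < hi)%N ->
  q k.+1 <= expR eta * q k /\ q k <= expR eta * q k.+1.
Hypotheses (e0 : 0 <= e) (e8 : e <= 8^-1).
Hypothesis window_prob : 1 - e <= Phi (x hi) - Phi (x lo).
Hypothesis M_large : M ^- 2 <= e.
Hypothesis mesh : (hi - lo)%:R / s ^+ 2 <= e.
Hypothesis distortion : expR ((hi - lo)%:R * eta) <= 1 + e.

Lemma quotient_comparison i j : (lo <= i <= hi)%N -> (lo <= j <= hi)%N ->
  q i <= (1 + e) * q j.
Proof.
have q0 k : 0 <= q k by rewrite divr_ge0 ?mulr_ge0 ?(ltW s0) ?(ltW (phi_gt0 _)).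
have main a b : (lo <= a)%N -> (a <= b <= hi)%N ->
    q b <= (1 + e) * q a /\ q a <= (1 + e) * q b.
  move=> la /andP[ab bh].
  have [|h1 h2] := @ratio_telescope q eta a (b - a).
    move=> k /andP[ak]; rewrite subnKC// => kb; apply: ratio.
    by rewrite (leq_trans la ak) (leq_trans kb bh).
  move: h1 h2; rewrite subnKC// => h1 h2.
  have E : expR ((b - a)%:R * eta) <= 1 + e.
    apply: le_trans distortion; rewrite ler_expR ler_wpM2r// ler_nat.
    exact: leq_sub.
  by split; [apply: le_trans h1 _|apply: le_trans h2 _]; rewrite ler_wpM2r.
move=> /andP[li ih] /andP[lj jh]; have [ij|/ltnW ji] := leqP i j.
  by have [] := main i j li; rewrite ?ij ?jh.
by have [] := main j i lj; rewrite ?ji ?ih.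
Qed.

(** Since [q] is constant up to a factor [1 + e], comparing the sum of [p] over the
window with the Riemann sum of [phi] determines that constant. *)
Lemma window_close k : (lo <= k <= hi)%N -> `|q k - 1| <= 8 * e.
Proof.
move=> kw.
have pE j : p j = q j * (phi (x j) / s).
  by rewrite /q; field; rewrite !gt_eqF// phi_gt0.
have g0 j : 0 <= phi (x j) / s by rewrite divr_ge0 ?(ltW s0) ?(ltW (phi_gt0 _)).
have q0 : 0 <= q k by rewrite divr_ge0 ?mulr_ge0 ?(ltW s0) ?(ltW (phi_gt0 _)).
have [Slo Shi] : 1 - 2 * e <= \sum_(lo <= j < hi) phi (x j) / s /\
    \sum_(lo <= j < hi) phi (x j) / s <= 1 + e.
  have := riemann_phi mu lo (hi - lo) s0; rewrite subnKC// ler_norml -/x.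
  have := Phi_le1 (x hi); have := Phi_ge0 (x lo).
  move: window_prob mesh => *; split; lra.
set S := \sum_(lo <= j < hi) phi (x j) / s in Slo Shi.
have cheb := chebyshev_window s0 M0 p0 p1 pv lohi hiN klo khi.
have le1 : \sum_(lo <= j < hi) p j <= 1.
  rewrite -p1 [leRHS](big_cat_nat (n := lo))// ?(leq_trans lohi)//=.
  rewrite [X in _ + X](big_cat_nat (n := hi))//= addrCA lerDl addr_ge0//.
    by apply: sumr_ge0.
  by apply: sumr_ge0.
have up : q k * S <= (1 + e) * \sum_(lo <= j < hi) p j.
  rewrite /S !mulr_sumr big_nat [leRHS]big_nat; apply: ler_sum => j /andP[lj jh].
  by rewrite pE (mulrA (1 + e)) ler_wpM2r// quotient_comparison// lj ltnW.
have dn : \sum_(lo <= j < hi) p j <= (1 + e) * q k * S.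
  rewrite /S mulr_sumr big_nat [leRHS]big_nat; apply: ler_sum => j /andP[lj jh].
  by rewrite pE ler_wpM2r// quotient_comparison// lj ltnW.
move: e0 e8 M_large => e0' e8' Ml.
have hup : q k * (1 - 2 * e) <= 1 + e.
  apply: le_trans (_ : q k * S <= _); first by rewrite ler_wpM2l.
  by apply: le_trans up _; rewrite ler_piMr// addr_ge0.
have hdn : 1 - e <= q k * (1 + e) ^+ 2.
  apply: (@le_trans _ _ ((1 + e) * q k * S)); first by lra.
  have -> : q k * (1 + e) ^+ 2 = (1 + e) * q k * (1 + e) by ring.
  by rewrite ler_wpM2l// mulr_ge0// addr_ge0.
exact: normB1_le8.
Qed.

Hypothesis left_le : forall k, (k <= lo)%N -> p k <= p lo.
Hypothesis right_le : forall k, (hi <= k)%N -> p k <= p hi.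
Hypothesis lo_le : lo%:R <= mu - M * s.
Hypothesis phiM : phi M <= e.

Lemma edge_small k : (lo <= k <= hi)%N -> M <= `|x k| -> s * p k <= 2 * e.
Proof.
move=> kw Mx; have := window_close kw; rewrite ler_norml => /andP[_ h].
have -> : s * p k = q k * phi (x k) by rewrite /q divfK// gt_eqF// phi_gt0.
have h2 : q k <= 2 by move: e8 h; lra.
have h3 : phi (x k) <= e.
  by apply: le_trans phiM; apply: le_phi; rewrite ger0_norm// ltW.
apply: le_trans (_ : 2 * phi (x k) <= _).
  by rewrite ler_wpM2r// ltW// phi_gt0.
by rewrite ler_wpM2l.
Qed.

(** [P] extends [p] by zero to the integers, where the rounded point lives. *)
Lemma local_bound (P : int -> R) :
  (forall k : nat, P k%:Z = p k) -> (forall k : int, k < 0 -> P k = 0) ->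
  forall y, `|s * P (Num.floor (mu + y * s)) - phi y| <= 8 * e + s^-1.
Proof.
move=> Pn Pneg y.
set k := Num.floor _; have /andP[kle ltk] := floor_itv (mu + y * s).
rewrite -/k in kle ltk.
have si0 : 0 <= s^-1 by rewrite invr_ge0 ltW.
have x_lo : x lo <= - M.
  by rewrite /x /standardize ler_pdivrMr// mulNr; move: lo_le; lra.
have x_hi : M <= x hi.
  by rewrite /x /standardize ler_pdivlMr//; have := khi (leqnn hi); lra.
have small v w : 0 <= v <= 2 * e -> 0 <= w <= e -> `|v - w| <= 8 * e + s^-1.
  by move: e0 => ? /andP[? ?] /andP[? ?]; rewrite ler_norml; lra.
have phiy : M <= `|y| -> 0 <= phi y <= e.
  move=> My; rewrite ltW ?phi_gt0//= (le_trans _ phiM)// le_phi//.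
  by rewrite (ger0_norm (ltW M0)).
have s_ge0 := ltW s0.
(* Left of the window both terms are small; a negative [k] makes the first one 0. *)
have [klt|lok] := ltP k lo%:Z.
  apply: small; last first.
    apply: phiy; rewrite ler_normr; apply/orP; right; rewrite lerNr.
    apply: le_trans x_lo; rewrite /x /standardize ler_pdivlMr//.
    have : (k + 1)%:~R <= lo%:R :> R by rewrite -[lo%:R]/(lo%:Z%:~R) ler_int lezD1.
    by move: ltk; lra.
  have [kneg|] := ltP k 0; first by rewrite Pneg// mulr0 lexx mulr_ge0.
  case: (k) klt => // j jlo _; rewrite Pn mulr_ge0//=.
  apply: (@le_trans _ _ (s * p lo)); first by rewrite ler_wpM2l// left_le// ltnW.
  apply: edge_small; first by rewrite leqnn.
  by rewrite ler_normr lerNr x_lo orbT.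
case: (k) lok kle ltk => // j; rewrite lez_nat => lok; rewrite -[j%:~R]/(j%:R) => kle ltk.
rewrite Pn.
(* Right of the window both terms are small as well. *)
have [hij|jhi] := leqP hi j.
  apply: small; last first.
    apply: phiy; rewrite ler_normr (le_trans x_hi)// /x /standardize ler_pdivrMr//.
    have : hi%:R <= j%:R :> R by rewrite ler_nat.
    by move: kle; lra.
  rewrite mulr_ge0//=.
  apply: (@le_trans _ _ (s * p hi)); first by rewrite ler_wpM2l// right_le.
  apply: edge_small; first by rewrite lohi leqnn.
  by rewrite ler_normr x_hi.
(* Inside, replacing [y] by the grid point [x j] costs at most one mesh [s^-1]. *)
have kw : (lo <= j <= hi)%N by rewrite lok ltnW.
have h1 : `|s * p j - phi (x j)| <= 8 * e.
  have -> : s * p j - phi (x j) = (q j - 1) * phi (x j).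
    by rewrite mulrBl mul1r /q divfK// gt_eqF// phi_gt0.
  rewrite normrM [`|phi _|]gtr0_norm ?phi_gt0//.
  by apply: le_trans (window_close kw); rewrite ler_piMr// phi_le1.
have h2 : `|phi (x j) - phi y| <= s^-1.
  apply: le_trans (phi_lipschitz _ _) _.
  have -> : x j - y = (j%:R - (mu + y * s)) / s.
    by rewrite /x /standardize; field; rewrite gt_eqF.
  rewrite normrM [`|s^-1|]ger0_norm// ler_piMl// ler_norml.
  by move: kle ltk; rewrite intrD -[j%:~R]/(j%:R); lra.
have -> : s * p j - phi y = (s * p j - phi (x j)) + (phi (x j) - phi y) by ring.
by apply: le_trans (ler_normD _ _) _; rewrite lerD.
Qed.

End Window.
End LocalLimit.

(** * Ratio estimate and local bound for the coefficient law *)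

(** A cleared-denominator form of the comparison of [u / D] with [5 t / (2 a)],
suited to polynomial bounds in [a] and [t]. *)
Lemma quotient_close (R : realFieldType) (a t D u C : R) : 0 < a ->
  2 * a ^+ 2 <= D -> `|2 * a * u - 5 * t * D| <= 4 * C * a ^+ 2 ->
  `|u / D - 5 / 2 * t / a| <= C / a.
Proof.
move=> a0 Da h.
have D0 : 0 < D by apply: lt_le_trans Da; rewrite mulr_gt0 ?exprn_gt0.
have C0 : 0 <= C.
  have := le_trans (normr_ge0 _) h; rewrite pmulr_lge0 ?exprn_gt0//.
  by rewrite pmulr_rge0.
have -> : u / D - 5 / 2 * t / a = (2 * a * u - 5 * t * D) / (2 * a * D).
  by field; rewrite !gt_eqF.
have aD : 0 < 2 * a * D by rewrite !mulr_gt0.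
rewrite normrM normfV (gtr0_norm aD) ler_pdivrMr//; apply: le_trans h _.
have -> : C / a * (2 * a * D) = 2 * C * D by field; rewrite gt_eqF.
have -> : 4 * C * a ^+ 2 = 2 * C * (2 * a ^+ 2) by ring.
by rewrite ler_wpM2l// mulr_ge0.
Qed.

(** [D2 / D1] is the ratio of the coefficients of index [k + 1] and [k], and [exp (- y)]
is the corresponding ratio of the Gaussian density. Both logarithms are close to
[- 5 t / (2 a)], where [t = k - a]. By [r <= exp (r - 1)], bounding [r - 1 + y] and
[r^-1 - 1 - y] from above is a two-sided estimate of [log r + y] that never
mentions the logarithm. The error is [O(1 / a)] because [t = O(sqrt a)]. *)
Lemma log_ratio_bounds (R : realFieldType) (a b K k mu v : R) :
  b ^+ 2 = a -> 10 <= b -> 1 <= K -> 4 * K <= b ->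
  `|mu - a| <= 1 -> `|v - 2 / 5 * a| <= 1 -> `|k - a| <= K * b ->
  let D1 := 2 * k * (2 * k + 1) in
  let D2 := 5 * a ^+ 2 - k ^+ 2 in
  let y := (k - mu + 2^-1) / v in
  let eta := (12 * K ^+ 2 + 11) / a in
  [/\ 0 < k, 0 < D2, D2 / D1 - 1 + y <= eta & D1 / D2 - 1 - y <= eta].
Proof.
move=> ba b10 K1 Kb mua va ka D1 D2 y eta.
have a100 : 100 <= a by rewrite -ba; nra.
(* Everything is expressed in [a] and [t]; in what follows [a^2] dominates [a t^2],
   [t^3] and [a t]. *)
pose t := k - a; have kE : k = a + t by rewrite /t; ring.
have ta : `|t| <= a / 4.
  by apply: le_trans ka _; rewrite -ba; nra.
have t2 : t ^+ 2 <= K ^+ 2 * a.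
  by rewrite -ba -exprMn -[leLHS]real_normK ?num_real// ler_sqr ?nnegrE ?mulr_ge0//; lra.
have t20 : 0 <= t ^+ 2 by exact: sqr_ge0.
have K20 : 1 <= K ^+ 2 by nra.
move: (ta); rewrite ler_norml => /andP[ta1 ta2].
have at2 : a * t ^+ 2 <= K ^+ 2 * a ^+ 2.
  have -> : K ^+ 2 * a ^+ 2 = a * (K ^+ 2 * a) by ring.
  by rewrite ler_wpM2l//; lra.
have t3 : `|t ^+ 3| <= a * t ^+ 2 / 4.
  rewrite exprS normrM (ger0_norm t20) [leRHS]mulrAC.
  by rewrite ler_wpM2r.
have atb : `|a * t| <= a ^+ 2 / 4.
  rewrite normrM gtr0_norm; last by lra.
  by rewrite expr2 -mulrA ler_wpM2l//; lra.
have a2 : 100 * a <= a ^+ 2 by nra.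
have t2a : t ^+ 2 <= a * t ^+ 2 by nra.
have t2b : t ^+ 2 <= a ^+ 2 / 16 by nra.
move: t3 atb; rewrite !ler_norml => /andP[t31 t32] /andP[at1 at3].
pose u := 10 * a * t + 5 * t ^+ 2 + 2 * a + 2 * t.
have D1E : D1 = 4 * a ^+ 2 + 8 * (a * t) + 4 * t ^+ 2 + 2 * a + 2 * t.
  by rewrite /D1 kE; ring.
have D2E : D2 = 4 * a ^+ 2 - 2 * (a * t) - t ^+ 2 by rewrite /D2 kE; ring.
have D1a : 2 * a ^+ 2 <= D1 by rewrite D1E; nra.
have D2a : 2 * a ^+ 2 <= D2 by rewrite D2E; lra.
have D10 : 0 < D1 by nra.
have D20 : 0 < D2 by nra.
have a0 : 0 < a by lra.
pose C := 12 * K ^+ 2 + 2.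
have q1 : `|u / D1 - 5 / 2 * t / a| <= C / a.
  apply: quotient_close => //.
  have -> : 2 * a * u - 5 * t * D1 = - 30 * (a * t ^+ 2) - 20 * t ^+ 3
     + 4 * a ^+ 2 - 6 * (a * t) - 10 * t ^+ 2 by rewrite D1E /u; ring.
  rewrite /C; have -> : 4 * (12 * K ^+ 2 + 2) * a ^+ 2
    = 48 * (K ^+ 2 * a ^+ 2) + 8 * a ^+ 2 by ring.
  by rewrite ler_norml; apply/andP; split; nra.
have q2 : `|u / D2 - 5 / 2 * t / a| <= C / a.
  apply: quotient_close => //.
  have -> : 2 * a * u - 5 * t * D2 = 20 * (a * t ^+ 2) + 5 * t ^+ 3
     + 4 * a ^+ 2 + 4 * (a * t) by rewrite D2E /u; ring.
  rewrite /C; have -> : 4 * (12 * K ^+ 2 + 2) * a ^+ 2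
    = 48 * (K ^+ 2 * a ^+ 2) + 8 * a ^+ 2 by ring.
  by rewrite ler_norml; apply/andP; split; lra.
have v4 : a / 4 <= v by move: va; rewrite ler_norml; lra.
have v0 : 0 < v by lra.
have q3 : `|5 / 2 * t / a - y| <= 9 / a.
  have -> : 5 / 2 * t / a - y
      = (5 * t * (v - 2 / 5 * a) - 2 * a * (a - mu + 2^-1)) / (2 * a * v).
    by rewrite /y kE; field; rewrite !gt_eqF.
  rewrite normrM normfV [`|2 * a * v|]gtr0_norm ?mulr_gt0//.
  rewrite ler_pdivrMr ?mulr_gt0//.
  have -> : 9 / a * (2 * a * v) = 18 * v by field; rewrite gt_eqF.
  have h1 : `|5 * t * (v - 2 / 5 * a)| <= 5 / 4 * a.
    rewrite normrM -[leRHS]mulr1 ler_pM// normrM ger0_norm//; lra.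
  have h2 : `|2 * a * (a - mu + 2^-1)| <= 3 * a.
    move: mua; rewrite normrM gtr0_norm ?mulr_gt0// !ler_norml => /andP[? ?].
    have -> : 3 * a = 2 * a * (3 / 2) by field.
    by rewrite ler_wpM2l ?mulr_ge0 ?(ltW a0)// ler_norml; lra.
  by apply: le_trans (ler_normB _ _) _; lra.
have r1 : D2 / D1 - 1 = - (u / D1).
  have -> : u = D1 - D2 by rewrite /u D1E D2E; ring.
  by field; rewrite gt_eqF.
have r2 : D1 / D2 - 1 = u / D2.
  have -> : u = D1 - D2 by rewrite /u D1E D2E; ring.
  by field; rewrite gt_eqF.
have etaE : eta = C / a + 9 / a by rewrite /eta /C; field; rewrite gt_eqF.
move: q1 q2 q3; rewrite r1 r2 etaE !ler_norml => /andP[? ?] /andP[? ?] /andP[? ?].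
by split=> //; lra.
Qed.

Section LocalQ.
Variable R : realType.
Implicit Types (n k : nat) (a b mu s e M : R).

Lemma probQ_ge0 n k : 0 <= probQ R n k.
Proof. by rewrite divr_ge0 ?coefQ_ge0// ltW// hornerQ_gt0. Qed.

Lemma probQ_ratio n k a : 5 * a ^+ 2 = n.+1%:R ^+ 2 ->
  2 * k%:R * (2 * k%:R + 1) * probQ R n k.+1
    = (5 * a ^+ 2 - k%:R ^+ 2) * probQ R n k.
Proof.
move=> ->; rewrite /probQ !mulrA -coefQ_ratio; congr (_ * _ / _).
by rewrite natrM natrD natrM.
Qed.

(** The ratio of coefficients passes 1 at about [k = a]. *)
Lemma probQ_rising n k a : 5 * a ^+ 2 = n.+1%:R ^+ 2 -> k.+1%:R <= a ->
  probQ R n k <= probQ R n k.+1.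
Proof.
move=> aE ka; case: k ka => [|k] ka.
  by rewrite {1}/probQ coefQ0 mul0r probQ_ge0.
have k0 : 0 < k.+1%:R :> R by rewrite ltr0n.
have D0 : 0 < 2 * k.+1%:R * (2 * k.+1%:R + 1) :> R.
  by rewrite !mulr_gt0// addr_gt0// mulr_gt0.
rewrite -(ler_pM2l D0) (probQ_ratio k.+1 aE) ler_wpM2r ?probQ_ge0//.
by move: ka; rewrite -natr1; nra.
Qed.

Lemma probQ_falling n k a : 5 * a ^+ 2 = n.+1%:R ^+ 2 -> 0 < a -> a <= k%:R ->
  probQ R n k.+1 <= probQ R n k.
Proof.
move=> aE a0 ka; have k0 : 0 < k%:R :> R by apply: lt_le_trans ka.
have D0 : 0 < 2 * k%:R * (2 * k%:R + 1) :> R.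
  by rewrite !mulr_gt0// addr_gt0// mulr_gt0.
rewrite -(ler_pM2l D0) (probQ_ratio k aE) ler_wpM2r ?probQ_ge0//; nra.
Qed.

Lemma Astar_nat n k : Astar n.+1 k%:Z = probQ R n k.
Proof.
rewrite /Astar /A /probQ lez_nat /=; case: leqP => // nk.
by rewrite coefQ_gt// mul0r.
Qed.

Lemma Astar_neg n (k : int) : k < 0 -> Astar n.+1 k = 0 :> R.
Proof. by rewrite /Astar /A => /lt_geF ->; rewrite mul0r. Qed.

(** The quotient [q] changes by the factor [D2 / D1 * expR y] in one step, and
[r <= exp (r - 1)] is applied to [D2 / D1] and to its inverse. *)
Lemma quotient_step (p : nat -> R) mu s eta k (D1 D2 : R) :
  0 < s -> (forall j, 0 <= p j) -> 0 < D1 -> 0 < D2 ->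
  D1 * p k.+1 = D2 * p k ->
  let y := (k%:R - mu + 2^-1) / s ^+ 2 in
  let q j := s * p j / phi (standardize mu s j) in
  D2 / D1 - 1 + y <= eta -> D1 / D2 - 1 - y <= eta ->
  q k.+1 <= expR eta * q k /\ q k <= expR eta * q k.+1.
Proof.
move=> s0 p0 D10 D20 pD y q h1 h2.
have q0 j : 0 <= q j by rewrite divr_ge0 ?mulr_ge0 ?(ltW s0) ?(ltW (phi_gt0 _)).
have qS : q k.+1 = D2 / D1 * expR y * q k.
  rewrite /q (phi_shift (standardize mu s k) (standardize mu s k.+1)).
  have -> : (standardize mu s k ^+ 2 - standardize mu s k.+1 ^+ 2) / 2 = - y.
    by rewrite standardizeS /standardize /y; field; rewrite gt_eqF.
  have -> : p k.+1 = D2 / D1 * p k.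
    by apply: (mulfI (lt0r_neq0 D10)); rewrite pD; field; rewrite gt_eqF.
  by rewrite expRN; field; rewrite !gt_eqF ?expR_gt0 ?phi_gt0.
have qk : q k = D1 / D2 * expR (- y) * q k.+1.
  by rewrite qS expRN; field; rewrite !gt_eqF ?expR_gt0.
have expRB1 (r : R) : r <= expR (r - 1).
  by apply: le_trans (expR_ge1Dx _); rewrite addrC subrK.
split.
  rewrite qS ler_wpM2r//; apply: (@le_trans _ _ (expR (D2 / D1 - 1 + y))).
    by rewrite expRD ler_wpM2r ?expR_ge0.
  by rewrite ler_expR.
rewrite {1}qk ler_wpM2r//; apply: (@le_trans _ _ (expR (D1 / D2 - 1 - y))).
  by rewrite expRD ler_wpM2r ?expR_ge0.
by rewrite ler_expR.
Qed.

(** All the conditions on [n] are lower bounds on [b], which has the order of magnitude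
of [sqrt n] and of the standard deviation; the window consists of the integers
within [M s] of the mean. *)
Lemma local_bound_Q n a b mu s e M :
  b ^+ 2 = a -> 5 * a ^+ 2 = n.+1%:R ^+ 2 ->
  \sum_(0 <= k < n.+2) k%:R * probQ R n k = mu ->
  \sum_(0 <= k < n.+2) (k%:R - mu) ^+ 2 * probQ R n k = s ^+ 2 ->
  0 <= s -> 0 < e -> e <= 8^-1 -> 1 <= M -> M^-1 <= e ->
  1 - e <= Phi M - Phi (- M) ->
  10 <= b -> 4 * (M + 1) <= b -> 4 * (2 * M + 1) / b <= e ->
  (2 * M + 1) * (12 * (M + 1) ^+ 2 + 11) / b <= ln (1 + e) ->
  forall y : R, `|s * Astar n.+1 (Num.floor (mu + y * s)) - phi y| <= 9 * e.
Proof.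
move=> ba aE muE vE s_ge0 e0 e8 M1 Me tails b10 Mb be bln y.
have b0 : 0 < b by lra.
have a100 : 100 <= a by rewrite -ba; nra.
have a0 : 0 < a by lra.
have mua := mean_close (ltW a0) aE muE.
have va := var_close (ltW a0) aE muE vE.
have [va1 va2] : a / 4 <= s ^+ 2 /\ s ^+ 2 <= a.
  by move: va; rewrite ler_norml => /andP[? ?]; split; lra.
have sb : s <= b.
  by rewrite -ler_sqr ?nnegrE ?ba// ltW.
have bs : b / 2 <= s.
  by rewrite -ler_sqr ?nnegrE ?divr_ge0 ?(ltW b0)// exprMn ba; lra.
have s0 : 0 < s by lra.
have M0 : 0 < M by lra.
have sM : 1 <= M * s by nra.
have Msb : M * s <= M * b by rewrite ler_wpM2l// ltW.
have Mba : M * b <= a / 4 - b by rewrite -ba; nra.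
move: (mua); rewrite ler_norml => /andP[mua1 mua2].
pose L := mu - M * s; pose H := mu + M * s.
have L0 : 0 <= L by rewrite /L; lra.
have H0 : 0 <= H by rewrite /H; lra.
pose lo := Num.truncn L; pose hi := (Num.truncn H).+1.
have /andP[loL Llo] := truncn_itv L0; have /andP[hiH Hhi] := truncn_itv H0.
rewrite -/lo in loL Llo; rewrite -/hi in Hhi.
have hiH' : hi%:R <= H + 1 by rewrite /hi -natr1 lerD2r.
have Llo' : L <= lo%:R + 1 by rewrite natr1 ltW.
have lohi : (lo <= hi)%N.
  by rewrite -(ler_nat R); move: loL Hhi; rewrite /L /H; lra.
have n2a : 2 * a <= n.+1%:R.
  by rewrite -ler_sqr ?nnegrE ?mulr_ge0 ?(ltW a0)// -aE; nra.
have hiN : (hi <= n.+2)%N.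
  by rewrite -(ler_nat R) -[n.+2%:R]natr1; move: hiH'; rewrite /H; lra.
have width : (hi - lo)%:R <= (2 * M + 1) * b.
  by rewrite natrB//; move: hiH' Llo'; rewrite /H /L; lra.
pose C := 12 * (M + 1) ^+ 2 + 11; pose eta := C / a.
have C0 : 0 <= C by rewrite /C addr_ge0// mulr_ge0// sqr_ge0.
have eta0 : 0 <= eta by rewrite divr_ge0// ltW.
have klo k : (k < lo)%N -> k%:R <= mu - M * s.
  by move=> kl; apply: le_trans loL; rewrite ler_nat ltnW.
have khi k : (hi <= k)%N -> mu + M * s <= k%:R.
  by move=> kh; apply: le_trans (ltW Hhi) _; rewrite ler_nat.
(* Within the window [k] stays within [(M + 1) * b] of [a]. *)
have ratio k : (lo <= k < hi)%N ->
    let q j := s * probQ R n j / phi (standardize mu s j) in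
    q k.+1 <= expR eta * q k /\ q k <= expR eta * q k.+1.
  move=> /andP[lk kh] q.
  have k1 : L - 1 <= k%:R.
    by have : lo%:R <= k%:R :> R; [rewrite ler_nat|move: Llo'; lra].
  have k2 : k%:R <= H by apply: le_trans hiH; rewrite ler_nat -ltnS.
  have ka : `|k%:R - a| <= (M + 1) * b.
    by move: k1 k2; rewrite /L /H ler_norml => *; lra.
  have M11 : 1 <= M + 1 by lra.
  have [k0 D20 h1 h2] := log_ratio_bounds ba b10 M11 Mb mua va ka.
  apply: quotient_step h1 h2 => //.
  - by move=> j; exact: probQ_ge0.
  - by rewrite !mulr_gt0// addr_gt0// mulr_gt0.
  - exact: probQ_ratio.
have x_hi : M <= standardize mu s hi.
  by rewrite /standardize ler_pdivlMr//; have := khi _ (leqnn hi); lra.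
have x_lo : standardize mu s lo <= - M.
  by rewrite /standardize ler_pdivrMr// mulNr; move: loL; rewrite /L; lra.
have window : 1 - e <= Phi (standardize mu s hi) - Phi (standardize mu s lo).
  by have := Phi_nondecreasing x_hi; have := Phi_nondecreasing x_lo; lra.
have Mi0 : 0 <= M^-1 by rewrite invr_ge0 ltW.
have M2 : M ^- 2 <= e.
  apply: le_trans Me; rewrite -exprVn expr2 ler_piMr//.
  by rewrite invf_le1.
have mesh : (hi - lo)%:R / s ^+ 2 <= e.
  apply: le_trans be; rewrite ler_pdivrMr ?exprn_gt0//.
  apply: (le_trans width).
  have -> : 4 * (2 * M + 1) / b * s ^+ 2 = (2 * M + 1) * (4 * s ^+ 2 / b).
    by field; rewrite gt_eqF.
  rewrite ler_wpM2l ?addr_ge0 ?mulr_ge0 ?(ltW M0)//.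
  by rewrite ler_pdivlMr// -expr2 ba; lra.
have distortion : expR ((hi - lo)%:R * eta) <= 1 + e.
  rewrite -[leRHS]lnK ?posrE ?addr_gt0// ler_expR; apply: le_trans bln.
  apply: (@le_trans _ _ ((2 * M + 1) * b * eta)); first by rewrite ler_wpM2r.
  by rewrite /eta /C -ba le_eqVlt; apply/orP; left; apply/eqP; field; rewrite gt_eqF.
(* The law increases up to [a] and decreases after it, and [a] lies well inside
   the window. *)
have left_le k : (k <= lo)%N -> probQ R n k <= probQ R n lo.
  move=> kl; rewrite -(subnKC kl).
  have : k%:R + (lo - k)%:R <= a.
    by rewrite -natrD subnKC//; move: loL; rewrite /L; lra.
  elim: (lo - k)%N => [|m IH] hm; first by rewrite addn0.
  rewrite addnS; apply: le_trans (probQ_rising aE _).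
    by apply: IH; move: hm; rewrite -natr1; lra.
  by rewrite -addnS natrD.
have right_le k : (hi <= k)%N -> probQ R n k <= probQ R n hi.
  move=> hk; rewrite -(subnKC hk).
  elim: (k - hi)%N => [|m IH]; first by rewrite addn0.
  rewrite addnS; apply: le_trans IH; apply: probQ_falling aE a0 _.
  have : hi%:R <= (hi + m)%:R :> R by rewrite ler_nat leq_addr.
  by move: Hhi; rewrite /H; lra.
have phiM : phi M <= e.
  apply: le_trans Me; rewrite -[M^-1]mul1r ler_pdivlMr// mulrC.
  by have := abs_mul_phi_le1 M; rewrite gtr0_norm.
have si : s^-1 <= e.
  apply: le_trans be; apply: (@le_trans _ _ (b / 2)^-1).
    by rewrite lef_pV2 ?posrE// divr_gt0.
  rewrite invf_div ler_wpM2r ?invr_ge0 ?(ltW b0)//; lra.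
have h := @local_bound R (probQ R n) n.+2 lo hi mu s M eta e s0 M0 eta0
  (probQ_ge0 n) (sum_probQ R n) vE lohi hiN klo khi ratio (ltW e0) e8 window M2
  mesh distortion left_le right_le loL phiM (Astar n.+1)
  (Astar_nat n) (@Astar_neg n) y.
by apply: le_trans h _; lra.
Qed.

End LocalQ.

(** * The local limit theorem *)

Theorem corollary1p10 (R : realType)
  (d : nat -> measure_display)
  (T : forall n : nat, measurableType (d n))
  (P : forall n : nat, probability (T n) R)
  (X : forall n : nat, {RV (P n) >-> R})
  (X_values : forall n : nat, (0 < n)%N ->
     forall w : T n, exists2 k : nat, (k <= n)%N & X n w = k%:R)
  (X_law : forall n k : nat, (0 < n)%N -> (k <= n)%N ->
     pmf (X n) k%:R = A n k%:Z / (Q n).[1])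
  (mu sigma : nat -> R)
  (mu_expectation : forall n : nat, (0 < n)%N ->
     ('E_(P n)[X n] = (mu n)%:E)%E)
  (sigma_ge0 : forall n : nat, (0 < n)%N -> 0 <= sigma n)
  (sigma_variance : forall n : nat, (0 < n)%N ->
     ('V_(P n)[X n] = (sigma n ^+ 2)%:E)%E) :
  (fun n : nat => ereal_sup [set
      `| sigma n * Astar n (Num.floor (mu n + x * sigma n)) - phi x |%:E
    | x in [set: R]]) @ \oo --> 0%:E.
Proof.
have law n k : (k < n.+2)%N -> pmf (X n.+1) k%:R = probQ R n k.
  by move=> kn; rewrite X_law// -[RHS]Astar_nat.
have muE n : \sum_(0 <= k < n.+2) k%:R * probQ R n k = mu n.+1.
  have := mu_expectation n.+1 (ltn0Sn n).
  rewrite (expectation_natvalued (X_values _ (ltn0Sn n))) => -[<-].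
  by apply: eq_big_nat => k /andP[_ kn]; rewrite law.
have vE n : \sum_(0 <= k < n.+2) (k%:R - mu n.+1) ^+ 2 * probQ R n k
    = sigma n.+1 ^+ 2.
  have := sigma_variance n.+1 (ltn0Sn n).
  rewrite (variance_natvalued (X_values _ (ltn0Sn n)) (mu_expectation _ (ltn0Sn n))).
  move=> -[<-].
  by apply: eq_big_nat => k /andP[_ kn]; rewrite law.
have bound eps : 0 < eps -> \forall n \near \oo, forall y,
    `|sigma n * Astar n (Num.floor (mu n + y * sigma n)) - phi y| <= eps.
  move=> eps0; pose e := Num.min (eps / 9) 8^-1.
  have e0 : 0 < e by rewrite lt_min divr_gt0//= invr_gt0.
  have e8 : e <= 8^-1 by rewrite ge_min lexx orbT.
  have e9 : 9 * e <= eps.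
    have : e <= eps / 9 by rewrite ge_min lexx.
    by lra.
  have [M0 tails] := Phi_tails e0.
  pose M := Num.max (Num.max M0 e^-1) 1.
  have M1 : 1 <= M by rewrite le_max lexx orbT.
  have MM0 : M0 <= M by rewrite !le_max lexx.
  have Me : M^-1 <= e.
    rewrite -[leRHS]invrK lef_pV2 ?posrE ?invr_gt0//; last by lra.
    by rewrite !le_max lexx orbT.
  have ln0 : 0 < ln (1 + e) by rewrite ln_gt0// ltrDl.
  (* [B] gathers the lower bounds that [b] has to satisfy in [local_bound_Q]. *)
  pose B := Num.max (Num.max 10 (4 * (M + 1)))
    (Num.max (4 * (2 * M + 1) / e) ((2 * M + 1) * (12 * (M + 1) ^+ 2 + 11) / ln (1 + e))).
  near=> n.
  have [m nE] : exists m, n = m.+1.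
    by exists n.-1; rewrite prednK//; near: n; exact: nbhs_infty_gt.
  pose a := n%:R / Num.sqrt 5 : R; pose b := Num.sqrt a.
  have s5 : 0 < Num.sqrt 5 :> R by rewrite sqrtr_gt0.
  have a0 : 0 <= a by rewrite divr_ge0// ltW.
  have bB : B <= b.
    have B0 : 0 <= B by rewrite !le_max ler0n.
    rewrite -(ger0_norm B0) -sqrtr_sqr ler_wsqrtr// ler_pdivlMr//.
    near: n; exact: nbhs_infty_ger.
  have b2 : b ^+ 2 = a by rewrite sqr_sqrtr.
  have a2 : 5 * a ^+ 2 = n%:R ^+ 2.
    by rewrite exprMn exprVn sqr_sqrtr//; field.
  move: bB; rewrite !ge_max => /andP[/andP[B1 B2] /andP[B3 B4]].
  have b0 : 0 < b by lra.
  move=> y; apply: le_trans e9; rewrite nE in a2 *.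
  apply: (local_bound_Q (M := M) b2 a2 (muE m) (vE m)) => //.
  - exact: sigma_ge0.
  - exact: tails.
  - by rewrite ler_pdivrMr// -ler_pdivrMl// mulrC.
  - by rewrite ler_pdivrMr// -ler_pdivrMl// mulrC.
apply/fine_cvgP.
have sup_bounds eps : 0 < eps -> \forall n \near \oo,
    (0 <= ereal_sup [set
      `| sigma n * Astar n (Num.floor (mu n + x * sigma n)) - phi x |%:E
    | x in [set: R]] <= eps%:E)%E.
  move=> /bound; apply: filterS => n H; apply/andP; split.
    apply: (@le_trans _ _ `|sigma n * Astar n (Num.floor (mu n + 0 * sigma n)) - phi 0|%:E).
      by rewrite lee_fin.
    by apply: ereal_sup_ubound; exists 0.
  by apply: ge_ereal_sup => _ [x _ <-]; rewrite lee_fin.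
split.
  apply: filterS (sup_bounds 1 ltr01) => n /andP[h0 h1].
  by rewrite ge0_fin_numE// (le_lt_trans h1) ?ltry.
apply/cvgrPdist_le => eps eps0; apply: filterS (sup_bounds eps eps0) => n /andP[h0 h1] /=.
rewrite sub0r normrN ger0_norm ?fine_ge0//.
by rewrite -lee_fin fineK// ge0_fin_numE// (le_lt_trans h1) ?ltry.
Unshelve. all: by end_near.
Qed.
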